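(* Let $m>1$ and $n\geqslant 0$ be integers, and let $h:\mathbb R^m\to\mathbb R^n$ be a map. Then $h$ is continuous and distance equality preserving if and only if $h$ is a similarity map.
   Context: $\mathbb R^m$ and $\mathbb R^n$ carry the Euclidean norm $|\cdot|$. A map $h:\mathbb R^m\to\mathbb R^n$ is called distance equality preserving if for all $x,y,z,w\in\mathbb R^m$, $|x-y|=|z-w|$ implies $|h(x)-h(y)|=|h(z)-h(w)|$. A map $h:\mathbb R^m\to\mathbb R^n$ is called a similarity map if it preserves all distances up to a multiplicative constant, that is, if there is a real constant $c\geqslant 0$ with $|h(x)-h(y)|=c\,|x-y|$ for all $x,y\in\mathbb R^m$ (the value $c=0$, i.e. a constant map, is allowed). *)

(* Defs.v *)
From HB Require Import structures.
From mathcomp Require Import all_boot all_order all_algebra.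
From mathcomp Require Import all_classical all_reals all_analysis.
Set Implicit Arguments.
Unset Strict Implicit.
Unset Printing Implicit Defensive.
Import Order.TTheory GRing.Theory Num.Theory.
Import numFieldNormedType.Exports.
Local Open Scope ring_scope.

(* R^n is 'rV[R]_n.  The library norm `|x| on 'rV[R]_n is the sup norm, so the
   Euclidean norm has to be defined; both induce the canonical topology of
   'rV[R]_n, the one used by the library predicate [continuous]. *)
Definition enorm (R : realType) (n : nat) (x : 'rV[R]_n) : R :=
  Num.sqrt (\sum_(i < n) x ord0 i ^+ 2).

Definition distance_equality_preserving (R : realType) (m n : nat)
    (h : 'rV[R]_m -> 'rV[R]_n) : Prop :=
  forall x y z w : 'rV[R]_m,
    enorm (x - y) = enorm (z - w) -> enorm (h x - h y) = enorm (h z - h w).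

Definition similarity_map (R : realType) (m n : nat)
    (h : 'rV[R]_m -> 'rV[R]_n) : Prop :=
  exists2 c : R, 0 <= c &
    forall x y : 'rV[R]_m, enorm (h x - h y) = c * enorm (x - y).

(* Main.v *)
Require Import Defs.
From HB Require Import structures.
From mathcomp Require Import all_boot all_order all_algebra.
From mathcomp Require Import all_classical all_reals all_analysis.
From mathcomp Require Import ring lra.
Import Order.TTheory GRing.Theory Num.Theory.
Import numFieldNormedType.Exports.
Local Open Scope ring_scope.
Set Implicit Arguments.
Unset Strict Implicit.

(** The easy half: a similarity preserves distance equality at sight, and it is
    Lipschitz for the Euclidean norms, hence continuous
    ([similarity_continuous]).

    For the converse, let [h] preserve distance equality, and consider its
    second differences
      D v w x = h (x + v + w) - h (x + v) - h (x + w) + h x.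
    The squared length of an alternating sum of four points is a combination of
    their squared mutual distances ([sqn_alternating]), so |D v w x| depends
    only on |v|, |w| and <v, w>: it ignores [x] and is invariant under rotating
    the pair (v, w) ([D2_congruent]).  The heart of the proof is that D
    vanishes ([D2_eq0]).

    - Fix v and a radius r.  The maps w |-> h (k v + w) - h (k v) of the sphere
      |w| = r, for k = 0, 1, 2 and so on, have values in one bounded set of R^n
      and all induce the same pseudometric on the sphere, that of h.  A bounded
      set of R^n can be cut into finitely many small pieces, so by the
      pigeonhole principle two of these maps, of indices i < j, are uniformly
      close: with k = j - i > 0, |D (k v) w x| is small for every x and for
      every w on the sphere ([almost_period]).
    - In dimension at least 2, the short vector v is a difference a - b of two
      vectors of the length of k v ([isosceles_split]).  Moving a, respectively
      b, onto k v by a reflection, which preserves the sphere, shows that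
      D a w and D b w are small, hence so is D v w, their difference up to base
      points.

    The first step uses that n is finite and the second that m > 1.  For m = 1
    the circle t |-> (cos t, sin t) is a counterexample.

    Since D = 0, v |-> h v - h 0 is additive; being continuous it is linear
    along a line, and its length at v depends only on |v|, so it multiplies all
    lengths by a constant ([dep_similarity]).

    Everything is written with squared lengths, and the parallelogram
    inequality [sqnB_le] stands in for the triangle inequality. *)

(** * Euclidean geometry of row vectors *)

Definition dot {R : realType} {n : nat} (x y : 'rV[R]_n) : R :=
  \sum_(i < n) x ord0 i * y ord0 i.

Notation sqn x := (dot x x).

Section Dot.
Context {R : realType} {n : nat}.
Implicit Types (x y z v w a b c d : 'rV[R]_n) (t : R).

Lemma dotC x y : dot x y = dot y x.
Proof. by apply: eq_bigr => i _; rewrite mulrC. Qed.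

Lemma dotDl x y z : dot (x + y) z = dot x z + dot y z.
Proof. by rewrite -big_split; apply: eq_bigr => i _; rewrite mxE mulrDl. Qed.

Lemma dotZl t x y : dot (t *: x) y = t * dot x y.
Proof. by rewrite [RHS]mulr_sumr; apply: eq_bigr => i _; rewrite mxE mulrA. Qed.

Lemma dotDr x y z : dot z (x + y) = dot z x + dot z y.
Proof. by rewrite dotC dotDl !(dotC z). Qed.

Lemma dotZr t x y : dot y (t *: x) = t * dot y x.
Proof. by rewrite dotC dotZl (dotC y). Qed.

Lemma dotNl x y : dot (- x) y = - dot x y.
Proof. by rewrite -scaleN1r dotZl mulN1r. Qed.

Lemma dotNr x y : dot y (- x) = - dot y x.
Proof. by rewrite dotC dotNl (dotC y). Qed.

Definition dotE := (dotDl, dotDr, dotNl, dotNr, dotZl, dotZr).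

Lemma sqn_ge0 x : 0 <= sqn x.
Proof. by apply: sumr_ge0 => i _; rewrite -expr2 sqr_ge0. Qed.

Lemma sqn_coord_le x i : x ord0 i ^+ 2 <= sqn x.
Proof.
rewrite /dot (bigD1 i) //= -expr2 lerDl; apply: sumr_ge0 => j _.
by rewrite -expr2 sqr_ge0.
Qed.

Lemma sqn_eq0 x : sqn x = 0 -> x = 0.
Proof.
move=> x0; apply/rowP => i; rewrite mxE; apply/eqP.
by rewrite -sqrf_eq0 eq_le sqr_ge0 andbT -x0 sqn_coord_le.
Qed.

Lemma sqn_gt0 x : x != 0 -> 0 < sqn x.
Proof.
by move=> x0; rewrite lt_def sqn_ge0 andbT; apply: contra x0 => /eqP/sqn_eq0->.
Qed.

Lemma enormE x : enorm x = Num.sqrt (sqn x).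
Proof. by rewrite /enorm; congr Num.sqrt; apply: eq_bigr => i _; rewrite expr2. Qed.

Lemma enorm_eq x y : enorm x = enorm y <-> sqn x = sqn y.
Proof.
rewrite !enormE; split=> [/(congr1 (fun t => t ^+ 2))|->//].
by rewrite !sqr_sqrtr ?sqn_ge0.
Qed.

Lemma sqnB_le x y : sqn (x - y) <= 2 * (sqn x + sqn y).
Proof.
have := sqn_ge0 (x + y); rewrite !dotE (dotC y x); lra.
Qed.

Lemma sqnD3_le x y z : sqn (x + y + z) <= 3 * (sqn x + sqn y + sqn z).
Proof.
have := sqn_ge0 (x - y); have := sqn_ge0 (x - z); have := sqn_ge0 (y - z).
rewrite !dotE (dotC y x) (dotC z x) (dotC z y); lra.
Qed.

(** It turns equality of distances into equality of lengths of second
    differences. *)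
Lemma sqn_alternating a b c d :
  sqn (a - b - c + d) = sqn (a - b) + sqn (c - d) + sqn (a - c) + sqn (b - d)
                        - sqn (a - d) - sqn (b - c).
Proof.
rewrite !dotE (dotC b a) (dotC c a) (dotC d a) (dotC c b) (dotC d b) (dotC d c).
ring.
Qed.

(** The reflection exchanging [a] and [a'], two vectors of the same length, is
    an isometry; [w'] is the image of [w]. *)
Lemma reflection_transport a a' w : sqn a = sqn a' ->
  exists2 w', sqn w' = sqn w & dot a' w' = dot a w.
Proof.
move=> aa'; have [<-|neq] := eqVneq a a'; first by exists w.
have [z [z0 z1 z2]] : exists z, [/\ sqn z != 0, 2 * dot a' z = - sqn z
    & dot a' w + dot w z = dot a w].
  exists (a - a'); split; first by rewrite gt_eqF // sqn_gt0 // subr_eq0.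
    by rewrite !dotE (dotC a' a) -aa'; ring.
  by rewrite !dotE (dotC w) (dotC w a'); ring.
exists (w - (2 * dot w z / sqn z) *: z).
  by rewrite !dotE (dotC z w); field.
have -> : dot a' (w - (2 * dot w z / sqn z) *: z)
   = dot a' w - dot w z * (2 * dot a' z) / sqn z by rewrite !dotE; field.
by rewrite z1 mulrN mulNr opprK mulfK.
Qed.

Lemma exists_unit_orthogonal v : (1 < n)%N -> exists2 u, sqn u = 1 & dot v u = 0.
Proof.
(* The kernel of the one-column matrix [v^T] has dimension at least n - 1 > 0. *)
move=> n1; pose u := nz_row (kermx v^T).
have u0 : u != 0.
  rewrite nz_row_eq0 -mxrank_eq0 mxrank_ker mxrank_tr subn_eq0 -ltnNge.
  by rewrite (leq_ltn_trans (rank_leq_row v)).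
have uv : dot v u = 0.
  have /sub_kermxP/matrixP/(_ ord0 ord0) := nz_row_sub (kermx v^T).
  by rewrite -/u dotC !mxE => <-; apply: eq_bigr => i _; rewrite mxE.
have su := sqn_gt0 u0.
exists ((Num.sqrt (sqn u))^-1 *: u); last by rewrite dotZr uv mulr0.
rewrite !dotE mulrA -invfM -expr2 sqr_sqrtr ?ltW // mulVf ?gt_eqF //.
Qed.

(** There is an isosceles triangle with base [v] and legs of squared length
    [t]: the apex lies on the perpendicular bisector of the base, which needs a
    second dimension. *)
Lemma isosceles_split v t : (1 < n)%N -> sqn v <= 4 * t ->
  exists a b, [/\ v = a - b, sqn a = t & sqn b = t].
Proof.
move=> n1 vt; have [u u1 vu] := exists_unit_orthogonal v n1.
pose s := Num.sqrt (t - sqn v / 4).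
have s2 : s * s = t - sqn v / 4 by rewrite -expr2 sqr_sqrtr //; lra.
exists (2^-1 *: v + s *: u), (- 2^-1 *: v + s *: u); split.
- by apply/rowP => i; rewrite !mxE; field.
- by rewrite !dotE (dotC u v) vu u1 mulr1 s2; field.
- by rewrite !dotE (dotC u v) vu u1 mulr1 s2; field.
Qed.

(** Total boundedness of balls, in the form suited to the pigeonhole principle:
    a grid of mesh 1/N cuts the cube of half-side N into finitely many cells. *)
Lemma finite_colouring (B e : R) : 0 < e ->
  exists (K : finType) (col : 'rV[R]_n -> K), forall x y,
    sqn x <= B -> sqn y <= B -> col x = col y -> sqn (x - y) <= e.
Proof.
move=> e0.
(* N is large enough for the ball to lie in the cube of half-side N, as
   B <= N <= N ^ 2, and for a cell to be small, as n / N ^ 2 <= n / N <= e. *)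
pose N := (Num.truncn (Num.max B (n%:R / e))).+1.
have /andP[BN neN] : (B < N%:R) && (n%:R / e < N%:R).
  by rewrite -gt_max truncnS_gt.
have N0 : 0 < N%:R :> R by rewrite ltr0n.
have N1 : 1 <= N%:R :> R by rewrite ler1n.
exists {ffun 'I_n -> 'I_(N * (N + N)).+1}.
exists (fun x => [ffun i => inord (Num.truncn (N%:R * (x ord0 i + N%:R)))]).
have bd x i : sqn x <= B -> - N%:R <= x ord0 i <= N%:R.
  move=> xB; rewrite -ler_norml -(ler_sqr (normr_ge0 _) (ltW N0)).
  rewrite real_normK ?num_real//; apply: le_trans (sqn_coord_le x i) _.
  apply: (le_trans xB); nra.
move=> x y xB yB /ffunP cxy.
have close i : (x ord0 i - y ord0 i) ^+ 2 <= N%:R ^- 2.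
  have code z : sqn z <= B -> (Num.truncn (N%:R * (z ord0 i + N%:R))
                               < (N * (N + N)).+1)%N.
    move=> /(bd _ i) zi; rewrite ltnS truncn_le_nat -natr1 natrM natrD; nra.
  have pos z : sqn z <= B -> 0 <= N%:R * (z ord0 i + N%:R).
    by move=> /(bd _ i) zi; nra.
  have /(congr1 (@nat_of_ord _)) := cxy i; rewrite !ffunE !inordK ?code // => exy.
  have := truncn_itv (pos _ xB); have := truncn_itv (pos _ yB).
  rewrite exy -natr1 => /andP[y1 y2] /andP[x1 x2].
  have : `|N%:R * (x ord0 i - y ord0 i)| <= 1 by rewrite ler_norml; lra.
  rewrite -(ler_sqr (normr_ge0 _) ler01) real_normK ?num_real// expr1n exprMn => h.
  by rewrite -[leRHS]mulr1 ler_pdivlMl ?exprn_gt0.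
apply: (@le_trans _ _ (n%:R * N%:R ^- 2)).
  rewrite mulr_natl -[X in _ *+ X]card_ord -sumr_const; apply: ler_sum => i _.
  by rewrite -expr2 !mxE close.
rewrite ler_pdivrMr ?exprn_gt0 //; move: neN; rewrite ltr_pdivrMr // => neN.
rewrite (le_trans (ltW neN)) // mulrC ler_pM2l // expr2; nra.
Qed.

End Dot.

(** * Second differences of distance equality preserving maps *)

Ltac row_ring := apply/rowP => ?; rewrite !mxE; ring.

Definition D2 {R : realType} {m n : nat} (h : 'rV[R]_m -> 'rV[R]_n) v w x :=
  h (x + v + w) - h (x + v) - h (x + w) + h x.

Section DistanceEqualityPreserving.
Variables (R : realType) (m n : nat) (h : 'rV[R]_m -> 'rV[R]_n).
Hypothesis hP : distance_equality_preserving h.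

Lemma dep_sqn x y z w : sqn (x - y) = sqn (z - w) ->
  sqn (h x - h y) = sqn (h z - h w).
Proof. by move/enorm_eq/hP/enorm_eq. Qed.

(** The six mutual distances of the corners of the parallelogram spanned by
    [v] and [w] at [x] are functions of |v|, |w| and <v, w>. *)
Lemma D2_congruent v w v' w' x x' :
  sqn v = sqn v' -> sqn w = sqn w' -> dot v w = dot v' w' ->
  sqn (D2 h v w x) = sqn (D2 h v' w' x').
Proof.
move=> vv ww vw; rewrite /D2 !sqn_alternating.
have sides (y y' : 'rV[R]_m) (p p' : 'rV[R]_m) : sqn p = sqn p' ->
    sqn (h (y + p) - h y) = sqn (h (y' + p') - h y').
  by move=> pp; apply: dep_sqn; rewrite addrC addKr (addrC y') addrK.
have e1 : sqn (h (x + v + w) - h (x + w)) = sqn (h (x' + v' + w') - h (x' + w')).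
  by rewrite (addrAC x v w) (addrAC x' v' w'); apply: sides.
have e2 : sqn (h (x + v) - h (x + w)) = sqn (h (x' + v') - h (x' + w')).
  have diff (y p q : 'rV[R]_m) : y + p - (y + q) = p - q by row_ring.
  by apply: dep_sqn; rewrite !diff !dotE (dotC w v) (dotC w' v') vv ww vw.
have e3 : sqn (h (x + v + w) - h x) = sqn (h (x' + v' + w') - h x').
  rewrite -!addrA; apply: sides.
  by rewrite !dotE (dotC w v) (dotC w' v') vv ww vw.
by rewrite (sides _ (x' + v') _ _ ww) (sides _ x' _ _ ww) (sides _ x' _ _ vv) e1 e2 e3.
Qed.

(** The images under [h] of the translates by k [v] of a sphere are congruent
    subsets of R^n.  Up to translation they range over a totally bounded family
    of shapes, so that two of them nearly coincide. *)
Lemma almost_period v r e : 0 < e ->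
  exists2 k, (0 < k)%N & forall w x, sqn w = r -> sqn (D2 h (k%:R *: v) w x) <= e.
Proof.
move=> e0; have [[w0 w0r]|none] := pselect (exists w0 : 'rV[R]_m, sqn w0 = r);
  last by exists 1%N => // w x wr; case: none; exists w.
pose B := sqn (h (0 + w0) - h 0).
have bound x w : sqn w = r -> sqn (h (x + w) - h x) <= B.
  move=> wr; rewrite (@dep_sqn _ _ (0 + w0) 0) // subr0 add0r w0r.
  by rewrite addrC addKr.
have d0 : 0 < e / 9 by lra.
have [K [col colP]] := @finite_colouring R n B _ d0.
(* A finite net of the sphere for the distance induced by [h]: one
   representative of each colour that occurs, and [w0] as default value. *)
pose rep c := xget w0 [set w | sqn w = r /\ col (h (0 + w) - h 0) = c]%classic.
have repP w : sqn w = r -> sqn (rep (col (h (0 + w) - h 0))) = r /\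
    col (h (0 + rep (col (h (0 + w) - h 0))) - h 0) = col (h (0 + w) - h 0).
  move=> wr; set c := col _.
  exact: (@xgetPex _ w0 [set u | sqn u = r /\ col (h (0 + u) - h 0) = c]%classic
    (ex_intro _ w (conj wr erefl))).
(* The approximate shape of h (i v + net) - h (i v); there are more indices [i]
   than possible shapes. *)
pose pattern (i : 'I_(#|{ffun K -> K}|.+1)) : {ffun K -> K} :=
  [ffun c => col (h (i%:R *: v + rep c) - h (i%:R *: v))].
have [i [j [ij pij]]] : exists i j : 'I_(#|{ffun K -> K}|.+1), (i < j)%N /\ pattern i = pattern j.
  have /injectivePn [i [j ij pij]] : ~~ injectiveb pattern.
    by apply/negP => /injectiveP/leq_card; rewrite card_ord ltnn.
  have [lt|lt|/val_inj eq] := ltngtP i j; first by exists i, j.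
    by exists j, i.
  by rewrite eq eqxx in ij.
exists (j - i)%N; first by rewrite subn_gt0.
move=> w x wr; set p := i%:R *: v; set s := (j - i)%:R *: v.
have ps : p + s = j%:R *: v by rewrite -scalerDl -natrD subnKC // ltnW.
rewrite (@D2_congruent _ _ s w x p) //.
have [w'r w'w] := repP w wr; set w' := rep _ in w'r w'w.
(* Replacing [w] by its representative [w'] costs the same at every base point,
   by translation invariance of the induced distance. *)
have near_shift y : sqn (h (y + w) - h (y + w')) <= e / 9.
  rewrite (@dep_sqn _ _ (0 + w) (0 + w')); last first.
    by congr (sqn _); row_ring.
  have -> : h (0 + w) - h (0 + w') = (h (0 + w) - h 0) - (h (0 + w') - h 0).
    by row_ring.
  by apply: colP; rewrite ?bound.
have near_rep : sqn (D2 h s w' p) <= e / 9.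
  have -> : D2 h s w' p = (h (p + s + w') - h (p + s)) - (h (p + w') - h p).
    by row_ring.
  apply: colP; rewrite ?bound // ps.
  by move/ffunP/(_ (col (h (0 + w) - h 0))): pij; rewrite !ffunE.
have -> : D2 h s w p = (h (p + s + w) - h (p + s + w'))
    + (- (h (p + w) - h (p + w'))) + D2 h s w' p.
  by row_ring.
apply: le_trans (sqnD3_le _ _ _) _; rewrite dotNl dotNr opprK.
have := near_shift (p + s); have := near_shift p; lra.
Qed.

(** Almost periods are long but control shorter vectors: [v] is the base of an
    isosceles triangle whose legs [a], [b] have the length of an almost period
    of the form k v. *)
Lemma D2_eq0 v w x : (1 < m)%N -> D2 h v w x = 0.
Proof.
move=> m1; apply: sqn_eq0; apply/eqP; rewrite eq_le sqn_ge0 andbT.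
apply/ler_addgt0Pr => e e0; rewrite add0r.
have d0 : 0 < e / 4 by lra.
have [k k0 kP] := almost_period v (sqn w) d0.
have [|a [b [vab aE bE]]] := isosceles_split (v := v) (t := sqn (k%:R *: v)) m1.
  have k1 : 1 <= k%:R :> R by rewrite ler1n.
  have k2 : 1 <= k%:R * k%:R :> R by nra.
  have := sqn_ge0 v; rewrite !dotE; nra.
have small c y : sqn c = sqn (k%:R *: v) -> sqn (D2 h c w y) <= e / 4.
  move=> cE; have [w' w'E w'c] := reflection_transport w cE.
  by rewrite (@D2_congruent _ _ (k%:R *: v) w' y y) // kP.
have -> : D2 h v w x = D2 h a w (x - b) - D2 h b w (x - b).
  rewrite /D2 subrK vab addrA (addrAC x).
  by row_ring.
apply: le_trans (sqnB_le _ _) _.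
have := small a (x - b) aE; have := small b (x - b) bE; lra.
Qed.

End DistanceEqualityPreserving.

(** * Additive continuous functions of a real variable *)

(** Additivity gives homogeneity over the rationals, which are dense. *)
Lemma additive_continuous_linear (R : realType) (V : normedModType R) (f : R -> V) :
  {morph f : x y / x + y} -> continuous f -> forall t, f t = t *: f 1.
Proof.
move=> fD fc.
have fB : {morph f : x y / x - y}.
  by move=> x y; rewrite -[in RHS](subrK y x) (fD (x - y)) addrK.
pose F : {additive R -> V} := HB.pack f (GRing.isZmodMorphism.Build R V f fB).
have fZ (z : int) x : f (x *~ z) = f x *~ z := raddfMz F z x.
have frat q : f (ratr q) = ratr q *: f 1.
  have d0 : (denq q)%:~R != 0 :> R by rewrite intr_eq0 denq_neq0.
  apply: (scalerI d0); rewrite scalerA scaler_int -fZ.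
  have -> : (denq q)%:~R * ratr q = (numq q)%:~R :> R by rewrite mulrC divfK.
  have -> : ratr q *~ denq q = 1 *~ numq q :> R.
    by rewrite -mulrzl mulrC divfK.
  by rewrite fZ scaler_int.
pose g t := f t - t *: f 1.
have gc : continuous g.
  move=> t; apply: cvgB; first exact: fc.
  exact: scalel_continuous.
have openN : open (~` (g @^-1` [set 0]))%classic.
  apply: closed_openC; apply: preimage_closed; first by move=> t _; apply: gc.
  exact: (accessible_closed_set1 (hausdorff_accessible (@norm_hausdorff _ V))).
move=> t; apply/eqP; rewrite -subr_eq0; apply/eqP; apply: contrapT => gt.
have [s [gs [q _ qs]]] := dense_rat (ex_intro _ t gt) openN.
by apply: gs; rewrite -qs /g /= frat subrr.
Qed.

(** * Comparison with the supremum norm, and similarities *)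

Lemma mx_norm_sqr_le (R : realType) n (x : 'rV[R]_n) : `|x| ^+ 2 <= sqn x.
Proof.
rewrite -[leRHS]sqr_sqrtr ?sqn_ge0 // ler_sqr ?nnegrE ?sqrtr_ge0 //.
rewrite [`|x|]mx_normrE; apply: bigmax_le; first exact: sqrtr_ge0.
move=> [i j] _ /=; rewrite (ord1 i) -sqrtr_sqr ler_wsqrtr //.
exact: sqn_coord_le.
Qed.

Lemma sqn_le_mx_norm (R : realType) n (x : 'rV[R]_n) : sqn x <= n%:R * `|x| ^+ 2.
Proof.
rewrite mulr_natl -[X in _ *+ X]card_ord -sumr_const; apply: ler_sum => i _.
rewrite -expr2 -(real_normK (num_real _)) ler_sqr ?nnegrE //.
rewrite [leRHS]mx_normrE.
exact: (le_bigmax _ (fun ij => `|x ij.1 ij.2|) (ord0, i)).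
Qed.

Lemma similarity_continuous (R : realType) m n (h : 'rV[R]_m -> 'rV[R]_n) :
  similarity_map h -> continuous h.
Proof.
move=> [c c0 hc] x; apply/(@cvgrPdist_le _ _ _ (nbhs x) _ h (h x)) => e e0.
(* Any C > 0 with c ^ 2 * m <= C ^ 2 would do; this one avoids square roots and
   stays positive when c = 0. *)
pose C := c * (m%:R + 1) + 1.
have m0 : 0 <= m%:R :> R by [].
have C0 : 0 < C by rewrite /C; nra.
have lip y : `|h x - h y| <= C * `|x - y|.
  rewrite -ler_sqr ?nnegrE ?mulr_ge0 ?(ltW C0) //.
  apply: le_trans (mx_norm_sqr_le _) _.
  have := congr1 (fun t => t ^+ 2) (hc x y).
  rewrite /= exprMn !enormE !sqr_sqrtr ?sqn_ge0 // => ->.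
  rewrite exprMn; apply: (@le_trans _ _ (c ^+ 2 * (m%:R * `|x - y| ^+ 2))).
    by rewrite ler_wpM2l ?sqr_ge0 // sqn_le_mx_norm.
  rewrite mulrA ler_wpM2r ?sqr_ge0 // /C.
  have cm : 0 <= c * m%:R by rewrite mulr_ge0.
  have : 0 <= (c * m%:R) ^+ 2 by rewrite sqr_ge0.
  have : 0 <= c * (c * m%:R) by rewrite mulr_ge0.
  nra.
near=> y; apply: le_trans (lip y) _; rewrite -ler_pdivlMl //.
near: y; apply: (@cvgr_dist_le _ _ _ (nbhs x) _ id x); first exact: cvg_id.
by rewrite mulr_gt0 ?invr_gt0.
Unshelve. all: by end_near. Qed.

Lemma similarity_dep (R : realType) m n (h : 'rV[R]_m -> 'rV[R]_n) :
  similarity_map h -> distance_equality_preserving h.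
Proof. by move=> [c _ hc] x y z w xyzw; rewrite !hc xyzw. Qed.

(** The ratio is read on the line through a unit vector [e]: the length of
    h x - h y depends only on |x - y|, so [x] and [y] may be replaced by
    |x - y| e and 0. *)
Lemma dep_similarity (R : realType) m n (h : 'rV[R]_m -> 'rV[R]_n) : (1 < m)%N ->
  continuous h -> distance_equality_preserving h -> similarity_map h.
Proof.
move=> m1 hc hP.
pose e : 'rV[R]_m := delta_mx ord0 (Ordinal (ltnW m1)).
have ee : sqn e = 1.
  rewrite /dot (bigD1 (Ordinal (ltnW m1))) //= big1 ?addr0 => [|i ine].
    by rewrite !mxE !eqxx mulr1.
  by rewrite !mxE (negPf ine) andbF mulr0.
pose f t := h (t *: e) - h 0.
have fD : {morph f : s t / s + t}.
  move=> s t; rewrite /f scalerDl -[RHS]add0r -(D2_eq0 hP (s *: e) (t *: e) 0 m1).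
  by rewrite /D2 !add0r; row_ring.
have fc : continuous f.
  move=> t; apply: cvgB; last exact: cvg_cst.
  exact: (continuous_comp (@scalel_continuous R _ e t) (hc (t *: e))).
have fl := additive_continuous_linear fD fc.
exists (enorm (f 1)); first by rewrite enormE sqrtr_ge0.
move=> x y; have -> : enorm (h x - h y) = enorm (f (enorm (x - y))).
  apply: hP; rewrite subr0; apply/enorm_eq.
  by rewrite dotZl dotZr ee mulr1 enormE -expr2 sqr_sqrtr ?sqn_ge0.
rewrite fl [LHS]enormE dotZl dotZr mulrA -expr2 sqrtrM ?sqr_ge0 // sqrtr_sqr.
by rewrite ger0_norm ?enormE ?sqrtr_ge0 // mulrC.
Qed.

Unset Implicit Arguments.
Set Strict Implicit.

Theorem theorem1 (R : realType) (m n : nat) (hm : (1 < m)%N)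
    (h : 'rV[R]_m -> 'rV[R]_n) :
  (continuous h /\ distance_equality_preserving h) <-> similarity_map h.
Proof.
split=> [[hc hP]|hs]; first exact: dep_similarity.
by split; [exact: similarity_continuous | exact: similarity_dep].
Qed.
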